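(* Let $\lambda\in[0,1]$ and let $U\in\mathbb{B}(\mathcal{H})$ be a partial isometry. Then $\sigma(U)=\sigma(P_{\lambda}(U))$.
   Context: $\mathbb{B}(\mathcal{H})$ denotes the bounded linear operators on a complex Hilbert space $\mathcal{H}$; $\sigma(\cdot)$ is the spectrum. Every $T\in\mathbb{B}(\mathcal{H})$ has a unique polar decomposition $T=V|T|$, where $|T|=(T^{*}T)^{1/2}$ and $V$ is a partial isometry with $\mathcal{N}(V)=\mathcal{N}(T)$. The Duggal transform is $T^{D}=|T|V$, the Aluthge transform is $\Delta(T)=|T|^{1/2}V|T|^{1/2}$, and for $\lambda\in[0,1]$ the power mean transform is $P_{\lambda}(T)=(1-\lambda)^2T+\lambda^2T^{D}+2\lambda(1-\lambda)\Delta(T)$. *)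

(* Defs.v *)
From HB Require Import structures.
From mathcomp Require Import all_boot all_order all_algebra.
From mathcomp Require Import complex.
From mathcomp Require Import boolp classical_sets functions reals.
From mathcomp Require Import topology normedtype.

Set Implicit Arguments.
Unset Strict Implicit.
Unset Printing Implicit Defensive.

Import Order.TTheory GRing.Theory Num.Theory Num.Def.
Import numFieldNormedType.Exports.

Local Open Scope classical_set_scope.
Local Open Scope complex_scope.
Local Open Scope ring_scope.

(* The inner product is linear in its first argument and conjugate-linear in
   the second. *)
HB.mixin Record isInnerProductSpace (R : realType) H
    of NormedModule R[i] H := {
  inner : {dot H for (@conjC R[i])};
  inner_normE : forall x : H, inner x x = `|x| ^+ 2 }.

#[short(type="hilbertType")]
HB.structure Definition Hilbert (R : realType) :=
  {H of CompleteNormedModule R[i] H & isInnerProductSpace R H}.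

Section Operators.
Context {R : realType} {H : hilbertType R}.
Implicit Types (T S A B V : H -> H) (lam : R).

Local Notation "''[' x , y ]" := (@inner R H x y) : ring_scope.

Definition bounded_operator : set (H -> H) :=
  [set T | linear T /\ exists M : R, forall x, `|T x| <= M%:C * `|x|].

(* Operators characterised by a property that determines them uniquely are
   selected by [xget]; the default value 0 is only taken when no bounded
   operator has the property. *)

Definition adjoint T : H -> H :=
  xget 0 [set S | bounded_operator S /\ forall x y, '[T x, y] = '[x, S y]].

Definition positive_operator A : Prop :=
  bounded_operator A /\ forall x, 0 <= '[A x, x].

Definition op_sqrt A : H -> H :=
  xget 0 [set B | positive_operator B /\ B \o B = A].

Definition op_abs T : H -> H := op_sqrt (adjoint T \o T).

Definition kernel T : set H := [set x | T x = 0].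

Definition orthocomp (E : set H) : set H :=
  [set x | forall y, E y -> '[x, y] = 0].

Definition partial_isometry V : Prop :=
  bounded_operator V /\ forall x, orthocomp (kernel V) x -> `|V x| = `|x|.

Definition polar_factor T : H -> H :=
  xget 0 [set V | [/\ partial_isometry V, kernel V = kernel T
                    & T = V \o op_abs T]].

Definition duggal T : H -> H := op_abs T \o polar_factor T.

Definition aluthge T : H -> H :=
  op_sqrt (op_abs T) \o polar_factor T \o op_sqrt (op_abs T).

Definition power_mean lam T : H -> H :=
  ((1 - lam) ^+ 2)%:C *: T + (lam ^+ 2)%:C *: duggal T
  + (2 * lam * (1 - lam))%:C *: aluthge T.

Definition spectrum T : set R[i] :=
  [set z | ~ exists2 S, bounded_operator S &
             S \o (T - z *: idfun) = idfun /\ (T - z *: idfun) \o S = idfun].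

End Operators.

(* Main.v *)
(* Write [P] for [U^* U]. Since [U] is isometric on the orthocomplement of its
   kernel, [P] is the orthogonal projection onto that orthocomplement, so
   [U P = U], and [|U|] and [|U|^(1/2)] are both [P], the only positive square
   root of [P]; the polar factor of [U] is [U] itself. Hence both transforms
   equal [P U], and [P_lam(U) = A U] with [A = a + (1 - a) P] and
   [a = (1 - lam)^2], while [U A = U]. Thus [U] and [P_lam(U)] are [U A] and
   [A U], whose spectra agree away from [0]. At [0]: if [U] or [A U] is
   injective then so is [U], so [P] is the identity and [A U = U]. *)
Require Import Defs.
From mathcomp Require Import all_boot all_order all_algebra.
From mathcomp Require Import complex.
From mathcomp Require Import boolp classical_sets functions reals.
From mathcomp Require Import topology normedtype.
From mathcomp Require Import ring lra.

Set Implicit Arguments.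
Unset Strict Implicit.
Unset Printing Implicit Defensive.

Import Order.TTheory GRing.Theory Num.Theory Num.Def.
Import numFieldNormedType.Exports.

Local Open Scope classical_set_scope.
Local Open Scope complex_scope.
Local Open Scope ring_scope.

(** * Algebra of bare functions carrying a proof of linearity *)

Section LinearMaps.
Context {K : pzRingType} {V W : lmodType K} (f : V -> W).
Context (lf : linear f).

Lemma linear_fun0 : f 0 = 0.
Proof. by have := lf (-1) 0 0; rewrite !scaleN1r !addNr. Qed.

Lemma linear_funZ a x : f (a *: x) = a *: f x.
Proof. by have := lf a x 0; rewrite !addr0 linear_fun0 addr0. Qed.

Lemma linear_funD x y : f (x + y) = f x + f y.
Proof. by have := lf 1 x y; rewrite !scale1r. Qed.

Lemma linear_funN x : f (- x) = - f x.
Proof. by rewrite -scaleN1r linear_funZ scaleN1r. Qed.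

Lemma linear_funB x y : f (x - y) = f x - f y.
Proof. by rewrite linear_funD linear_funN. Qed.

End LinearMaps.

(** * Inner product identities, Cauchy-Schwarz and the parallelogram law *)

Section InnerProduct.
Context {R : realType} {H : hilbertType R}.
Implicit Types (x y z : H) (a : R[i]).

Local Notation "''[' x , y ]" := (@inner R H x y) : ring_scope.

Lemma innerDl x y z : '[x + y, z] = '[x, z] + '[y, z].
Proof. exact: linearDl. Qed.

Lemma innerBl x y z : '[x - y, z] = '[x, z] - '[y, z].
Proof. exact: linearBl. Qed.

Lemma innerZl a x y : '[a *: x, y] = a * '[x, y].
Proof. exact: linearZl_LR. Qed.

Lemma innerDr x y z : '[x, y + z] = '[x, y] + '[x, z].
Proof. exact: linearDr. Qed.

Lemma innerBr x y z : '[x, y - z] = '[x, y] - '[x, z].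
Proof. exact: linearBr. Qed.

Lemma innerZr a x y : '[x, a *: y] = a^* * '[x, y].
Proof. exact: linearZr_LR. Qed.

Lemma inner0r x : '[x, 0] = 0.
Proof. exact: linear0r. Qed.

Lemma innerC x y : '[x, y] = '[y, x]^*.
Proof. by rewrite hermC /= mul1r. Qed.

Lemma inner_eq0C x y : '[x, y] = 0 -> '[y, x] = 0.
Proof. by move=> xy; rewrite innerC xy rmorph0. Qed.

Lemma inner_eq0 x : '[x, x] = 0 -> x = 0.
Proof. by move/eqP; rewrite inner_normE expf_eq0 /= normr_eq0 => /eqP. Qed.

Lemma inner_ge0 x : 0 <= '[x, x].
Proof. by rewrite inner_normE exprn_ge0. Qed.

Lemma conj_inner_self x : '[x, x]^* = '[x, x].
Proof. by rewrite -innerC. Qed.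

Lemma innerIr x y : (forall z, '[z, x] = '[z, y]) -> x = y.
Proof.
move=> xy; apply/eqP; rewrite -subr_eq0; apply/eqP/inner_eq0.
by rewrite innerBr xy subrr.
Qed.

(** This [a] makes the residual orthogonal to [y], so Pythagoras applies. The formula serves both
    Cauchy-Schwarz and the orthogonality of nearest-point residuals. *)
Lemma innerB_proj x y : y != 0 ->
  let a := '[x, y] / '[y, y] in
  '[x - a *: y, x - a *: y] = '[x, x] - `|'[x, y]| ^+ 2 / '[y, y].
Proof.
move=> y0 a; have yy0 : '[y, y] != 0 by apply: contra_neq y0 => /inner_eq0.
rewrite !innerBl !innerBr !innerZl !innerZr normCK (innerC y x) /a.
rewrite fmorph_div /= conj_inner_self.
by field.
Qed.

Lemma cauchy_schwarz x y : `|'[x, y]| <= `|x| * `|y|.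
Proof.
have [->|y0] := eqVneq y 0; first by rewrite inner0r !normr0 mulr0.
have := inner_ge0 (x - ('[x, y] / '[y, y]) *: y).
rewrite innerB_proj// !inner_normE subr_ge0.
rewrite ler_pdivrMr ?exprn_gt0 ?normr_gt0// -exprMn.
by rewrite ler_pXn2r ?nnegrE ?mulr_ge0.
Qed.

(* The norm of a hilbertType takes its values in R[i]; its real part is the
   same number seen in the ordered field R. *)
Definition rnorm x : R := complex.Re `|x|.

Lemma rnormE x : `|x| = (rnorm x)%:C.
Proof. by rewrite RRe_real// normr_real. Qed.

Lemma rnorm_ge0 x : 0 <= rnorm x.
Proof. by rewrite -ler0c -rnormE. Qed.

Lemma ler_rnormD x y : rnorm (x + y) <= rnorm x + rnorm y.
Proof. by rewrite -lecR rmorphD/= -!rnormE ler_normD. Qed.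

Lemma rnormZ (t : R) x : 0 <= t -> rnorm (t%:C *: x) = t * rnorm x.
Proof.
move=> t0; apply: (@complexI R); rewrite -rnormE normrZ rmorphM/= -rnormE.
by rewrite ger0_norm// ler0c.
Qed.

Lemma parallelogram x y :
  rnorm (x + y) ^+ 2 + rnorm (x - y) ^+ 2
    = 2 * (rnorm x ^+ 2 + rnorm y ^+ 2).
Proof.
apply: (@complexI R); rewrite !(rmorphD, rmorphM, rmorphXn)/= -!rnormE.
rewrite -!expr2 -!inner_normE !(innerBl, innerBr, innerDl, innerDr).
by rewrite rmorph1; ring.
Qed.

End InnerProduct.

(** * Nearest points and orthogonal projection onto closed subspaces *)

Section Projection.
Context {R : realType} {H : hilbertType R}.
Implicit Types (x y z : H) (M : set H).

Local Notation "''[' x , y ]" := (@inner R H x y) : ring_scope.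

Definition closed_subspace M :=
  [/\ M 0, forall (a : R[i]) x y, M x -> M y -> M (a *: x + y) &
      forall x, (forall e : R, 0 < e -> exists2 y, M y & rnorm (x - y) < e) ->
        M x].

(* The sets of [e]-near minimisers of the distance to [x] generate a filter,
   which the parallelogram law shows to be Cauchy. *)
Lemma nearest_point M x : closed_subspace M ->
  exists2 m, M m & forall y, M y -> rnorm (x - m) <= rnorm (x - y).
Proof.
move=> [M0 Mlin Mclosed].
pose D := [set rnorm (x - y) | y in M]; pose d := inf D.
have Dlb : lbound D 0 by move=> _ [y _ <-]; exact: rnorm_ge0.
have Dinf : has_inf D by split; [exists (rnorm (x - 0)), 0 | exists 0].
have dP y : M y -> d <= rnorm (x - y).
  by move=> My; apply: (ge_inf (proj2 Dinf)); exists y.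
have d0 : 0 <= d by apply: lb_le_inf Dlb; case: Dinf.
pose B (e : R) := [set y | M y /\ rnorm (x - y) < d + e].
have Bne e : 0 < e -> exists y, B e y.
  by move=> e0; have [_ [y My <-] ?] := inf_adherent e0 Dinf; exists y.
pose F : set_system H := [set A | exists2 e, 0 < e & B e `<=` A].
have FF : ProperFilter F.
  split.
    by move=> [e e0 Be]; have [y /Be] := Bne _ e0.
  split.
  - by exists 1.
  - move=> P Q [e e0 eP] [e' e'0 e'Q]; exists (Num.min e e').
      by rewrite lt_min e0.
    move=> y [My]; rewrite -ltrBlDl lt_min !ltrBlDl => /andP[ye ye'].
    by split; [exact: eP|exact: e'Q].
  - by move=> P Q PQ [e e0 eP]; exists e => // y /eP /PQ.
have Bclose e y z : B e y -> B e z ->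
    rnorm (y - z) ^+ 2 <= 4 * (2 * d * e + e ^+ 2).
  move=> [My yd] [Mz zd].
  (* The midpoint of [y] and [z] lies in [M], hence at distance at least [d] from [x]; the
     parallelogram law then leaves at most [4 (d + e)^2 - 4 d^2] for the difference. *)
  have h : d <= rnorm ((1 / 2)%:C *: ((x - y) + (x - z))).
    rewrite (_ : _ *: _ = x - ((1 / 2)%:C *: (y + z))).
      apply: dP; rewrite -[_ *: _]addr0; apply: (Mlin _ _ _) => //.
      by rewrite -[y]scale1r; exact: Mlin.
    rewrite addrACA -opprD scalerBr; congr (_ - _).
    rewrite -(mulr2n x) -(scaler_nat 2 x) scalerA -(rmorph_nat (real_complex R) 2).
    by rewrite -rmorphM divfK ?pnatr_eq0// rmorph1 scale1r.
  rewrite rnormZ in h; last by lra.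
  have := parallelogram (x - y) (x - z).
  have -> : x - y - (x - z) = - (y - z) by rewrite opprB addrC addrA subrK opprB.
  have -> : rnorm (- (y - z)) = rnorm (y - z) by rewrite /rnorm normrN.
  have := rnorm_ge0 (x - y); have := rnorm_ge0 (x - z).
  by move: (rnorm (x - y)) (rnorm (x - z)) yd zd h => *; nra.
have Fcauchy : cauchy F.
  apply: cauchy_exP => eps eps0.
  have epsE : eps = (complex.Re eps)%:C by rewrite RRe_real// gtr0_real.
  move: eps0; rewrite epsE -[0]/(0%:C) ltcR.
  move: (complex.Re eps) => {epsE}eps eps0.
  (* Since [e <= 1], the bound of [Bclose] is at most [4 (2 d + 1) e], hence at most [eps^2 / 2]. *)
  pose e := Num.min 1 (eps ^+ 2 / (8 * (2 * d + 1))).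
  have e0 : 0 < e by rewrite lt_min ltr01 divr_gt0// ?exprn_gt0//; lra.
  have [y By] := Bne e e0.
  exists y, e => // z Bz; rewrite -ball_normE /ball_ /= rnormE ltcR.
  rewrite -(@ltr_pXn2r _ 2)// ?nnegrE ?rnorm_ge0 ?(ltW eps0)//.
  apply: (le_lt_trans (Bclose _ _ _ By Bz)).
  have e1 : e <= 1 by rewrite ge_min lexx.
  have : e <= eps ^+ 2 / (8 * (2 * d + 1)) by rewrite ge_min lexx orbT.
  rewrite ler_pdivlMr; last by lra.
  have : 0 < eps ^+ 2 by rewrite exprn_gt0.
  by nra.
have Fm : F --> lim F := cauchy_cvg _ Fcauchy.
set m := lim F in Fm.
have near_m (e e' : R) : 0 < e -> 0 < e' -> exists2 y, B e' y & rnorm (m - y) < e.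
  move=> e0 e'0.
  have : F (ball m e%:C) by apply: Fm; apply: nbhsx_ballx; rewrite ltcR.
  move=> [e'' e''0 He''].
  have [|y [My ye]] := Bne (Num.min e' e''); first by rewrite lt_min e'0.
  move: ye; rewrite -ltrBlDl lt_min !ltrBlDl => /andP[ye' ye''].
  exists y => //; have := He'' y (conj My ye'').
  by rewrite -ball_normE /ball_/= rnormE ltcR.
exists m.
  by apply: Mclosed => e e0; have [y [My _]] := near_m _ _ e0 e0; exists y.
move=> y My; apply: le_trans (dP _ My); apply/ler_addgt0Pr => e e0.
have e20 : 0 < e / 2 by rewrite divr_gt0.
have [z [Mz zd] zm] := near_m _ _ e20 e20.
have -> : x - m = (x - z) + (z - m) by rewrite addrA subrK.
apply: le_trans (ler_rnormD _ _) _.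
have -> : rnorm (z - m) = rnorm (m - z) by rewrite /rnorm distrC.
lra.
Qed.

(** Moving the nearest point [m] by [a *: y] would lower the squared distance by [|'[x - m, y]|^2 /
    '[y, y]], so minimality forces this quantity to vanish. *)
Lemma orthogonal_projection M x : closed_subspace M ->
  exists2 m, M m & forall y, M y -> '[x - m, y] = 0.
Proof.
move=> clM; have [m Mm xm] := nearest_point x clM; exists m => // y My.
have [->|y0] := eqVneq y 0; first exact: inner0r.
have [M0 Mlin _] := clM.
pose a := '[x - m, y] / '[y, y].
have := xm _ (Mlin a _ _ My Mm); rewrite opprD addrCA addrC.
rewrite -(@ler_pXn2r _ 2)// ?nnegrE ?rnorm_ge0// -lecR !rmorphXn/= -!rnormE.
rewrite -!inner_normE innerB_proj// lerBrDr gerDl => h.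
have yy : 0 < '[y, y] by rewrite inner_normE exprn_gt0// normr_gt0.
move: h; rewrite pmulr_lle0 ?invr_gt0// => h.
by apply/eqP; rewrite -normr_eq0 -sqrf_eq0 eq_le h exprn_ge0.
Qed.

End Projection.

(** * Riesz representation, adjoints, positive square roots and polarization *)

Section Operators.
Context {R : realType} {H : hilbertType R}.
Implicit Types (x y z : H) (T S A B : H -> H).

Local Notation "''[' x , y ]" := (@inner R H x y) : ring_scope.

Lemma closed_subspace_kernel (W : normedModType R[i]) (f : H -> W) (C : R) :
  linear f -> (forall x, `|f x| <= C%:C * `|x|) ->
  closed_subspace [set x | f x = 0].
Proof.
move=> lf fC; split => /= [|a x y fx fy|x xclose].
- exact: linear_fun0.
- by rewrite lf fx fy scaler0 addr0.
apply/eqP; rewrite -normr_eq0; apply: contraT => fx0.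
have fxE : `|f x| = (complex.Re `|f x|)%:C by rewrite RRe_real// normr_real.
have r0 : 0 < complex.Re `|f x|.
  by rewrite -ltcR -fxE rmorph0 lt_def fx0 normr_ge0.
(* The given [C] may be nonpositive; dividing by [D + 1] keeps the radius below positive. *)
have [D D0 CD] : exists2 D : R, 0 <= D & C <= D.
  by exists `|C|; rewrite ?ler_norm.
have D1 : 0 < D + 1 by rewrite ltr_wpDl.
have [|y fy xy] := xclose (complex.Re `|f x| / (D + 1)); first exact: divr_gt0.
have := fC (x - y); rewrite linear_funB// fy subr0 rnormE {1}fxE -rmorphM lecR.
move: xy; rewrite ltr_pdivlMr//; have := rnorm_ge0 (x - y).
by clear -D0 CD r0; move: (rnorm _) (complex.Re _) r0 => *; nra.
Qed.

(** Unless [f] vanishes, some [u] outside its kernel is orthogonal to that kernel. Each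
    [x - (f x / f u) *: u] is in the kernel, so pairing it with [u] yields [f x]. *)
Lemma riesz_representation (f : H -> R[i]^o) (C : R) :
  linear f -> (forall x, `|f x| <= C%:C * `|x|) ->
  exists w, forall x, f x = '[x, w].
Proof.
move=> lf fC; have clM := closed_subspace_kernel lf fC.
have [f0|/existsNP[x0 fx0]] := pselect (forall x, f x = 0).
  by exists 0 => x; rewrite f0 inner0r.
have [m /= fm zorth] := orthogonal_projection x0 clM; set u := x0 - m in zorth.
have fu : f u != 0 by rewrite linear_funB// fm subr0; apply/eqP.
have uu : '[u, u] != 0.
  by apply: contra_neq fu => /inner_eq0 ->; rewrite linear_fun0.
exists ((f u / '[u, u])^* *: u) => x.
have /zorth/inner_eq0C : [set x | f x = 0] (x - (f x / f u) *: u).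
  by rewrite /= linear_funB// linear_funZ// -[_ *: _]/(_ * _) divfK ?subrr.
rewrite innerBl innerZl => /eqP; rewrite subr_eq0 innerZr conjCK => /eqP ->.
by field; rewrite fu uu.
Qed.

Lemma bounded_operator_ge0 T : bounded_operator T ->
  exists2 C : R, 0 <= C & forall x, `|T x| <= C%:C * `|x|.
Proof.
move=> [_ [C TC]]; exists `|C| => // x; apply: le_trans (TC x) _.
by rewrite ler_wpM2r// lecR ler_norm.
Qed.

Lemma bounded_operator_id : bounded_operator (idfun : H -> H).
Proof. by split => //; exists 1 => x; rewrite mul1r. Qed.

Lemma bounded_operator_comp T S :
  bounded_operator T -> bounded_operator S -> bounded_operator (T \o S).
Proof.
move=> bT bS; have [C C0 TC] := bounded_operator_ge0 bT.
have [D D0 SD] := bounded_operator_ge0 bS.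
split=> [a x y|]; first by rewrite /= (proj1 bS) (proj1 bT).
exists (C * D) => x /=; apply: le_trans (TC _) _.
by rewrite rmorphM/= -mulrA ler_wpM2l// ler0c.
Qed.

Lemma bounded_operator_lincomb (a b : R[i]) T S :
  bounded_operator T -> bounded_operator S ->
  bounded_operator (fun x => a *: T x + b *: S x).
Proof.
move=> [lT [C TC]] [lS [D SD]]; split=> [c x y|].
  by rewrite lT lS !scalerDr addrACA !scalerA !(mulrC c).
have normE (c : R[i]) : exists r : R, `|c| = r%:C.
  by exists (complex.Re `|c|); rewrite RRe_real// normr_real.
have [[r aE] [s bE]] := (normE a, normE b).
exists (r * C + s * D) => x; rewrite rmorphD !rmorphM/= -aE -bE.
by rewrite (le_trans (ler_normD _ _))// mulrDl !normrZ -!mulrA lerD// ler_wpM2l.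
Qed.

(** Exhibiting one adjoint rules out the default of [xget]. Riesz gives it pointwise as [S], and [|S
    y|^2 = '[T (S y), y] <= C |S y| |y|] bounds it. *)
Lemma adjointP T : bounded_operator T ->
  bounded_operator (adjoint T) /\ forall x y, '[T x, y] = '[x, adjoint T y].
Proof.
move=> bT; have [C C0 TC] := bounded_operator_ge0 bT; have [lT _] := bT.
rewrite /adjoint; set P := (P in xget _ P).
suff: exists S, P S by move/(@xgetPex _ 0).
have /choice[S TS] : forall y, exists w, forall x, '[T x, y] = '[x, w].
  move=> y; apply: (@riesz_representation _ (C * rnorm y)) => [a u v|x].
    by rewrite lT innerDl innerZl.
  apply: le_trans (cauchy_schwarz _ _) _.
  by rewrite rmorphM/= -rnormE mulrAC ler_wpM2r.
exists S; split=> //; split=> [a x y|].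
  by apply: innerIr => z; rewrite -TS !innerDr !innerZr !TS.
exists C => y; have [->|Sy0] := eqVneq (S y) 0.
  by rewrite normr0 mulr_ge0// ler0c.
rewrite -(@ler_pM2l _ `|S y|) ?normr_gt0// -expr2 -inner_normE -TS.
have TSy0 : 0 <= '[T (S y), y] by rewrite TS inner_ge0.
rewrite -(ger0_norm TSy0) (le_trans (cauchy_schwarz _ _))// mulrCA mulrA.
by rewrite ler_wpM2r.
Qed.

Lemma positive_sq_inj B w : positive_operator B -> B (B w) = 0 -> B w = 0.
Proof.
move=> [[lB _] Bpos] BBw; set v := B w in BBw *.
have [->//|v0] := eqVneq v 0.
have vv0 : 0 < '[v, v] by rewrite inner_normE exprn_gt0 ?normr_gt0.
have c0 : 0 <= '[v, w] by exact: Bpos.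
(* As [B v = 0], the quadratic form of [B] at [w + t *: v] is ['[v, w] + t '[v, v]] for real [t];
   this [t] makes it [-1]. *)
have := Bpos (w + (- ('[v, w] + 1) / '[v, v]) *: v).
rewrite (linear_funD lB) (linear_funZ lB) BBw scaler0 addr0 -/v innerDr innerZr.
rewrite (CrealP _); last by rewrite rpredM ?rpredV ?rpredN ?rpredD ?ger0_real// ltW.
rewrite divfK ?gt_eqF// opprD addrA subrr add0r.
by rewrite oppr_ge0 ler10.
Qed.

(** For any positive root [B], the vector [y = B (A x) - A x] satisfies [B y = - y], so positivity
    kills it and [B A = A]. Moreover [B] squared kills [x - A x], hence so does [B], and
    [B x = B (A x) = A x]. *)
Lemma op_sqrt_idempotent A :
  positive_operator A -> A \o A = A -> op_sqrt A = A.
Proof.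
move=> posA AA.
have AAE x : A (A x) = A x by rewrite -[in RHS]AA.
rewrite /op_sqrt; set P := (P in xget _ P).
have [posB BB] : P (xget 0 P) by apply: (@xgetPex _ 0); exists A.
move: (xget 0 P) posB BB => B posB BB.
have BBE x : B (B x) = A x by rewrite -BB.
have [[lA _] _] := posA; have [[lB _] Bpos] := posB.
have BA x : B (A x) = A x.
  set y := B (A x) - A x.
  have By : B y = - y by rewrite /y linear_funB// BBE AAE opprB.
  apply/eqP; rewrite -subr_eq0 -/y; apply/eqP/inner_eq0/eqP.
  have := Bpos y; rewrite By -scaleN1r innerZl mulN1r oppr_ge0 => yy.
  by rewrite eq_le yy inner_ge0.
apply/funext => x; apply/eqP; rewrite -BA -subr_eq0 -linear_funB//; apply/eqP.
by apply: positive_sq_inj => //; rewrite BBE linear_funB// AAE subrr.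
Qed.

(** Polarization, restricted to [E] because a partial isometry preserves norms only off its kernel:
    [a = 1] and [a = 'i] give the sum and the difference of an inner product and its conjugate. *)
Lemma isometry_inner T (E : set H) : linear T ->
  (forall (a : R[i]) x y, E x -> E y -> E (x + a *: y)) ->
  (forall x, E x -> `|T x| = `|x|) ->
  forall x y, E x -> E y -> '[T x, T y] = '[x, y].
Proof.
move=> lT Elin Tiso x y Ex Ey.
have iso z : E z -> '[T z, T z] = '[z, z].
  by move=> /Tiso; rewrite !inner_normE => ->.
have polar a : a^* * '[T x, T y] + a * '[T y, T x] = a^* * '[x, y] + a * '[y, x].
  have := iso _ (Elin a _ _ Ex Ey).
  rewrite (linear_funD lT) (linear_funZ lT) !innerDl !innerDr !innerZl !innerZr.
  rewrite !iso// => h.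
  apply: (@addrI _ '[x, x]); apply: (@addIr _ (a * (a^* * '[y, y]))).
  by rewrite !addrA -!addrA in h *; rewrite h.
have h1 := polar 1; rewrite rmorph1 !mul1r in h1.
have i0 : ('i : R[i]) != 0 by rewrite neq0Ci.
have := polar 'i; rewrite conjCi !mulNr => hi.
have h2 : '[T y, T x] - '[T x, T y] = '[y, x] - '[x, y].
  apply: (mulfI i0); rewrite !mulrBr.
  by rewrite ![_ - 'i * _]addrC.
apply: (mulfI (_ : 2%:R != 0 :> R[i])); first by rewrite pnatr_eq0.
rewrite (_ : 2%:R * '[T x, T y] = '[T x, T y] + '[T y, T x]
  - ('[T y, T x] - '[T x, T y])); last by ring.
by rewrite h1 h2; ring.
Qed.


End Operators.

(** * Polar decomposition and power mean of a partial isometry *)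

Section PartialIsometry.
Context {R : realType} {H : hilbertType R}.
Implicit Types (x y z : H) (lam : R).
Context (U : H -> H) (hU : partial_isometry U).

Local Notation "''[' x , y ]" := (@inner R H x y) : ring_scope.
Local Notation P := (adjoint U \o U).

Let bU : bounded_operator U. Proof. by case: hU. Qed.
Let lU : linear U. Proof. by case: bU. Qed.

(** Let [p] and [q] be the components of [x] and [y] orthogonal to the kernel. Then ['[U y, U x] =
    '[U q, U p] = '[q, p] = '[y, p]], so [adjoint U (U x)] is [p], and [U p = U x]. *)
Lemma adjoint_partial_isometryK x : U (adjoint U (U x)) = U x.
Proof.
have [_ [C UC]] := bU; have [_ adjU] := adjointP bU.
have decomp z : exists2 p, orthocomp (kernel U) p & U z = U p /\
    forall q, orthocomp (kernel U) q -> '[z, q] = '[p, q].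
  have [m Um zm] := orthogonal_projection z (closed_subspace_kernel lU UC).
  exists (z - m) => [//|]; split=> [|q Eq].
    by rewrite (linear_funB lU) Um subr0.
  by rewrite innerBl (inner_eq0C (Eq m Um)) subr0.
have [p Ep [-> _]] := decomp x; congr U; apply: innerIr => y.
have [q Eq [Uy yp]] := decomp y.
rewrite -adjU Uy yp//; apply: (isometry_inner lU _ (proj2 hU)) => //.
by move=> a u v Eu Ev w Uw; rewrite innerDl innerZl Eu// Ev// mulr0 addr0.
Qed.

Lemma positive_operator_adjoint_comp : positive_operator P.
Proof.
have [bA adjU] := adjointP bU; split; first exact: bounded_operator_comp.
by move=> x; rewrite innerC /= -adjU conj_inner_self inner_ge0.
Qed.

Lemma adjoint_comp_idempotent : P \o P = P.
Proof. by apply/funext => x /=; rewrite adjoint_partial_isometryK. Qed.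

Lemma op_abs_partial_isometry : op_abs U = P.
Proof.
exact: op_sqrt_idempotent positive_operator_adjoint_comp adjoint_comp_idempotent.
Qed.

(** [U] is a candidate, and any candidate [V] has [U = V \o P]. So [V x - U x = V (x - P x)], which
    vanishes because [x - P x] lies in the common kernel. *)
Lemma polar_factor_partial_isometry : polar_factor U = U.
Proof.
rewrite /polar_factor op_abs_partial_isometry; set Q := (Q in xget _ Q).
have [[[lV _] _] kerV UV] : Q (xget 0 Q).
  apply: (@xgetPex _ 0); exists U; split => //.
  by apply/funext => x /=; rewrite adjoint_partial_isometryK.
apply/funext => x; rewrite [in RHS]UV /=; apply/eqP; rewrite -subr_eq0.
rewrite -(linear_funB lV); apply/eqP.
suff : kernel (xget 0 Q) (x - adjoint U (U x)) by [].
by rewrite kerV /kernel /= (linear_funB lU) adjoint_partial_isometryK subrr.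
Qed.

Lemma power_mean_partial_isometry lam x :
  let a := ((1 - lam) ^+ 2)%:C in
  power_mean lam U x = a *: U x + (1 - a) *: P (U x).
Proof.
move=> a; rewrite /power_mean /duggal /aluthge.
rewrite polar_factor_partial_isometry op_abs_partial_isometry.
rewrite op_sqrt_idempotent; [|exact: positive_operator_adjoint_comp
                             |exact: adjoint_comp_idempotent].
(* The Aluthge term [P (U (P x))] becomes [P (U x)], like the Duggal term; their weights add up to
   [lam^2 + 2 lam (1 - lam) = 1 - (1 - lam)^2]. *)
rewrite /= !fctE /= adjoint_partial_isometryK -addrA -scalerDl.
congr (_ + _ *: _); rewrite -(rmorph1 (real_complex R)) -rmorphB -rmorphD /=.
by congr (_%:C); ring.
Qed.

Lemma power_mean_injective_partial_isometry lam :
  injective U -> power_mean lam U = U.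
Proof.
move=> Uinj; apply/funext => x; rewrite power_mean_partial_isometry /=.
by rewrite (Uinj _ _ (adjoint_partial_isometryK _)) -scalerDl addrC subrK scale1r.
Qed.

End PartialIsometry.

(** * Spectra of products in either order, and the point zero *)

Section Spectrum.
Context {R : realType} {H : hilbertType R}.
Implicit Types (A B T : H -> H) (z : R[i]).

(* From an inverse [S] of [B A - z] with [z <> 0] one gets the inverse
   [z^-1 (A S B - 1)] of [A B - z]. *)
Lemma spectrum_comp_sub A B z : bounded_operator A -> bounded_operator B ->
  z != 0 -> spectrum (A \o B) z -> spectrum (B \o A) z.
Proof.
move=> bA bB z0 + [S bS [SK KS]]; apply.
have [lA _] := bA; have [lB _] := bB; have [lS _] := bS.
have SKE x : S (B (A x) - z *: x) = x by move/(congr1 (@^~ x)): SK.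
have KSE x : B (A (S x)) - z *: S x = x by move/(congr1 (@^~ x)): KS.
exists (fun x => z^-1 *: (A \o S \o B) x + (- z^-1) *: idfun x).
  apply: bounded_operator_lincomb (bounded_operator_id).
  exact: bounded_operator_comp (bounded_operator_comp bA bS) bB.
split; apply/funext => x; rewrite /= !fctE /=.
  have -> : B (A (B x) - z *: x) = B (A (B x)) - z *: B x.
    by rewrite (linear_funB lB) (linear_funZ lB).
  by rewrite SKE scaleNr -scalerBr subKr scalerA mulVf// scale1r.
set w := S (B x).
have -> : B (z^-1 *: A w + (- z^-1) *: x) = w.
  rewrite (linear_funD lB) !(linear_funZ lB) scaleNr -scalerBr.
  by rewrite -[B x in LHS]KSE -/w subKr scalerA mulVf// scale1r.
rewrite scalerDr !scalerA mulrN mulfV// scaleN1r scale1r.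
by rewrite opprD opprK addrA subrr add0r.
Qed.

Lemma spectrum_comp A B z : bounded_operator A -> bounded_operator B ->
  z != 0 -> spectrum (A \o B) z <-> spectrum (B \o A) z.
Proof. by move=> bA bB z0; split; exact: spectrum_comp_sub. Qed.

Lemma spectrum0_noninjective T : ~ injective T -> spectrum T 0.
Proof.
move=> Tninj [S _ [ST _]]; apply: Tninj; apply: (can_inj (g := S)) => x.
by move/(congr1 (@^~ x)): ST; rewrite /= !fctE /= scale0r subr0.
Qed.

End Spectrum.

Theorem corollary2p7 (R : realType) (H : hilbertType R) (lam : R)
    (U : H -> H) (hlam : 0 <= lam <= 1) (hU : partial_isometry U) :
  spectrum U = spectrum (power_mean lam U).
Proof.
have [Uinj|Uninj] := pselect (injective U).
  by rewrite power_mean_injective_partial_isometry.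
have [bU _] := hU; have [bA _] := adjointP bU.
pose a : R[i] := ((1 - lam) ^+ 2)%:C.
pose A x := a *: idfun x + (1 - a) *: (adjoint U \o U) x.
have bopA : bounded_operator A.
  apply: bounded_operator_lincomb; first exact: bounded_operator_id.
  exact: bounded_operator_comp.
have UA : U \o A = U.
  apply/funext => x; rewrite /A /= (linear_funD (proj1 bU)).
  rewrite !(linear_funZ (proj1 bU)) adjoint_partial_isometryK//.
  by rewrite -scalerDl addrC subrK scale1r.
have AU : A \o U = power_mean lam U.
  by apply/funext => x; rewrite power_mean_partial_isometry.
(* With [U] not injective, [0] belongs to both spectra; elsewhere [U \o A] and [A \o U] are
   compared. *)
apply/seteqP; split=> z; have [->|z0] := eqVneq z 0.
- move=> _; apply: spectrum0_noninjective => Winj; apply: Uninj => x y Uxy.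
  by apply: Winj; rewrite -AU /= Uxy.
- by rewrite -{1}UA -AU => /spectrum_comp; apply.
- by move=> _; apply: spectrum0_noninjective.
- by rewrite -AU -{2}UA => /spectrum_comp; apply.
Qed.
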